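(* Let $\ell\ge 5$ be a prime number, $N>0$ an integer prime to $\ell$, and $k>2$ an integer. Let $f\in S_{k}(\Gamma_{0}(N))$ be a normalized eigenform and let $\lambda$ be a prime of $K_f$ lying over $\ell$. Suppose the representation $\rho_{f,\ell}=\rho_{f,\lambda}$ is irreducible. Let $i$ be an integer with $0\le i \le \ell-1$ such that, with $$H=\{x \bmod N\ell \ :\ 0<x<N\ell,\ \gcd(x,N\ell)=1,\ \varepsilon(x)\,x^{k-2-2i} \equiv 1 \bmod \lambda \}\subseteq (\mathbb{Z}/N\ell\mathbb{Z})^{*},\qquad \Gamma_H=\Gamma_H(N\ell)$$ (where $\varepsilon$ is the nebentypus character of $f$, here trivial), there exist a normalized eigenform $f_2\in S_2(\Gamma_H)$ and a prime $\lambda_2$ of $K_{f_2}$ over $\ell$ with $\rho_{f,\lambda}\cong\rho_{f_2,\lambda_2}\otimes\chi_\ell^i$. Then $\Gamma_H=\Gamma_{0}(N\ell)$ if and only if $\ell-1$ divides $k-2-2i$.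
   Context: For a positive integer $n$ and a subgroup $H$ of $(\mathbb{Z}/n\mathbb{Z})^{*}$, $\Gamma_H(n)$ is the group of matrices $\begin{pmatrix} a&b\\c&d\end{pmatrix}\in SL(2,\mathbb{Z})$ with $c\equiv 0 \pmod n$ and $d \bmod n\in H$; $\Gamma_0(n)$ and $\Gamma_1(n)$ are the cases $H=(\mathbb{Z}/n\mathbb{Z})^*$ and $H=\{1\}$. $S_k(\Gamma)$ is the space of cusp forms of weight $k$ on $\Gamma$. A normalized eigenform $g=\sum_{m>0}a_m(g)q^m$ is a Hecke eigenform with $a_1(g)=1$; $K_g$ is the number field generated by all the coefficients $a_m(g)$. For a normalized eigenform $g\in S_k(\Gamma_1(n))$ with nebentypus $\varepsilon$ and a prime $\mu$ of $K_g$ over $\ell$, with residue field embedded in $\overline{\mathbb{F}}_\ell$, $\rho_{g,\mu}:\mathrm{Gal}(\overline{\mathbb{Q}}/\mathbb{Q})\to GL_2(\overline{\mathbb{F}}_\ell)$ is the unique (up to isomorphism) continuous semisimple representation, unramified outside $n\ell$, such that for all primes $p\nmid n\ell$ the characteristic polynomial of $\rho_{g,\mu}(\mathrm{Frob}_p)$ is $x^2-a_p(g)x+\varepsilon(p)p^{k-1} \bmod \mu$; isomorphisms between representations attached to different forms are understood for suitable embeddings of residue fields. $\chi_\ell$ is the mod $\ell$ cyclotomic character. Negative powers of $x$ are taken modulo $\ell$. *)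

(* Defs.v *)
(* The field of complex numbers is R[i] for R : realType, and the algebraic
   closure of Q is algC. *)
From HB Require Import structures.
From mathcomp Require Export all_boot all_order all_algebra all_field.
From mathcomp Require Export all_classical all_reals all_analysis.
From mathcomp Require Export complex.

Set Implicit Arguments.
Unset Strict Implicit.
Unset Printing Implicit Defensive.

Export Order.TTheory GRing.Theory Num.Theory numFieldNormedType.Exports.

#[global] Open Scope classical_set_scope.
#[global] Open Scope ring_scope.

Definition SL2Z : set 'M[int]_2 := [set g | \det g = 1].

(* A subset H of (Z/nZ)^* is given by a set of natural numbers representing
   its classes. *)
Definition GammaH (n : nat) (H : set nat) : set 'M[int]_2 :=
  [set g | [/\ SL2Z g, (n %| g 1%R 0%R)%Z
             & exists2 x : nat, H x & (g 1%R 1%R = x %[mod n])%Z]].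

Definition Gamma0 (n : nat) : set 'M[int]_2 := GammaH n [set x | coprime x n].

Definition Gamma1 (n : nat) : set 'M[int]_2 := GammaH n [set 1%N].

Section ModularForms.
Variable R : realType.

(* A function on the upper half-plane is represented by f : R[i] -> R[i]; its
   values outside the upper half-plane are never used. *)
Definition upper_half_plane : set R[i] := [set z | 0 < complex.Im z].

Definition cexp (z : R[i]) : R[i] :=
  real_complex R (expR (complex.Re z))
  * Complex (cos (complex.Im z)) (sin (complex.Im z)).

Definition nome (z : R[i]) : R[i] :=
  cexp (Complex 0 (2 * pi) * z).

Definition slash (k : nat) (f : R[i] -> R[i]) (g : 'M[int]_2) (z : R[i]) :
    R[i] :=
  ((g 1 0)%:~R * z + (g 1 1)%:~R) ^- k
  * f (((g 0 0)%:~R * z + (g 0 1)%:~R) / ((g 1 0)%:~R * z + (g 1 1)%:~R)).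

Definition eq_on_uhp (f g : R[i] -> R[i]) : Prop :=
  {in upper_half_plane, f =1 g}.

(* Complex differentiability, R[i] being the scalar field. *)
Definition holomorphic_on_uhp (f : R[i] -> R[i]) : Prop :=
  forall z, upper_half_plane z -> derivable (f : R[i]^o -> R[i]^o) z 1.

Definition vanishes_at_ioo (f : R[i] -> R[i]) : Prop :=
  forall e : R[i], 0 < e -> exists A : R, forall z : R[i],
    upper_half_plane z -> A < complex.Im z -> `|f z| < e.

(* Vanishing at all the cusps is vanishing at infinity of all
   the translates of f under SL(2, Z). *)
Definition cusp_form (G : set 'M[int]_2) (k : nat) (f : R[i] -> R[i]) : Prop :=
  [/\ holomorphic_on_uhp f,
      forall g, G g -> eq_on_uhp (slash k f g) f
    & forall g, SL2Z g -> vanishes_at_ioo (slash k f g)].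

Definition has_qexpansion (f : R[i] -> R[i]) (a : nat -> R[i]) : Prop :=
  forall z, upper_half_plane z ->
    (series (fun m => a m * nome z ^+ m) : nat -> R[i]^o) @ \oo
      --> (f z : R[i]^o).

(* a_m(f); the expansion of a form on a group containing Gamma1 n exists and is
   unique. *)
Definition qcoef (f : R[i] -> R[i]) : nat -> R[i] :=
  xget (fun=> 0) [set a | has_qexpansion f a].

(* <d>, for d prime to n, acting on the forms on Gamma1 n: the action of any
   element of Gamma0 n with lower right entry congruent to d. *)
Definition diamond (n k d : nat) (f : R[i] -> R[i]) : R[i] -> R[i] :=
  slash k f (xget 1%:M [set g | Gamma0 n g /\ (g 1%R 1%R = d %[mod n])%Z]).

(* T_m in level n, also when m is not prime to n: the matrices (a, b; 0, d)
   with a * d = m, 0 <= b < d and a prime to n. *)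
Definition hecke (n k m : nat) (f : R[i] -> R[i]) (z : R[i]) : R[i] :=
  m%:R ^+ k.-1 *
  \sum_(a <- divisors m | coprime a n) \sum_(b < m %/ a)
    (m %/ a)%:R ^- k * diamond n k a f ((a%:R * z + b%:R) / (m %/ a)%:R).

Definition normalized_eigenform (n k : nat) (f : R[i] -> R[i]) : Prop :=
  [/\ exists2 z, upper_half_plane z & f z != 0,
      forall d, coprime d n ->
        exists c : R[i], eq_on_uhp (diamond n k d f) (fun z => c * f z),
      forall m, (0 < m)%N ->
        exists c : R[i], eq_on_uhp (hecke n k m f) (fun z => c * f z)
    & qcoef f 1 = 1].

(* The eigenvalue of <d>, for d prime to n and f a nonzero eigenform. *)
Definition nebentypus (n k : nat) (f : R[i] -> R[i]) (d : nat) : R[i] :=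
  xget 0 [set c | eq_on_uhp (diamond n k d f) (fun z => c * f z)].

Definition coef_field (f : R[i] -> R[i]) : set R[i] :=
  [set x | forall S : {pred R[i]},
     divring_closed S -> (forall m, qcoef f m \in S) -> x \in S].

Definition integers_of (K : set R[i]) : set R[i] :=
  [set x | K x /\ integralOver (intr : int -> R[i]) x].

End ModularForms.

(* O is a subring of A; ideals of O are subsets of A. *)
Definition prime_ideal (A : comNzRingType) (O I : set A) : Prop :=
  [/\ I `<=` O, I 0 /\ ~ I 1,
      forall x y, I x -> I y -> I (x + y),
      forall x y, O x -> I y -> I (x * y)
    & forall x y, O x -> O y -> I (x * y) -> I x \/ I y].

Definition prime_over (A : comNzRingType) (O : set A) (p : nat) (I : set A) :
    Prop :=
  prime_ideal O I /\ I p%:R.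

(* r induces a field embedding O / I -> F; its values outside O are irrelevant. *)
Definition residue_embedding (A : comNzRingType) (O I : set A) (F : fieldType)
    (r : A -> F) : Prop :=
  [/\ r 1 = 1,
      forall x y, O x -> O y -> r (x - y) = r x - r y,
      forall x y, O x -> O y -> r (x * y) = r x * r y
    & forall x, O x -> (r x = 0 <-> I x)].

Definition algebraic_closure_Fp (p : nat) (F : closedFieldType) : Prop :=
  p \in [pchar F]
  /\ forall x : F, algebraicOver (fun a : 'F_p => (a : nat)%:R : F) x.

(* The absolute Galois group of Q: every ring endomorphism of algC is an
   automorphism. *)
Definition absGal := {rmorphism algC -> algC}.

Definition Zbar : set algC := [set x | x \in Aint].

(* For P a prime of Zbar over p. The congruences force s to preserve P. *)
Definition inertia (P : set algC) : set absGal :=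
  [set s : absGal | forall x, Zbar x -> P (s x - x)].

Definition frobenius (p : nat) (P : set algC) : set absGal :=
  [set s : absGal | forall x, Zbar x -> P (s x - x ^+ p)].

Section GaloisRep.
Variable F : fieldType.
Implicit Types rho : absGal -> 'M[F]_2.

Definition is_rep rho : Prop :=
  [/\ forall s, rho s \in unitmx, rho idfun = 1%:M
    & forall s t : absGal, rho (s \o t) = rho s *m rho t].

(* Continuity for the Krull topology and the discrete topology on GL_2(F). *)
Definition continuous_rep rho : Prop :=
  forall s : absGal, exists X : seq algC,
    forall t : absGal, {in X, s =1 t} -> rho t = rho s.

(* Matrices act on column vectors; the subspace described by U : 'M_2 is the
   space of the transposes of the elements of the row space of U. *)
Definition stable_rep rho (U : 'M[F]_2) : Prop :=
  forall s, stablemx U (rho s)^T.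

Definition irreducible_rep rho : Prop :=
  forall U : 'M[F]_2, stable_rep rho U -> U = 0 \/ row_full U.

Definition semisimple_rep rho : Prop :=
  forall U : 'M[F]_2, stable_rep rho U ->
    exists W : 'M[F]_2,
      [/\ stable_rep rho W, row_full (U + W)%MS & (U :&: W)%MS = 0].

Definition isomorphic_rep rho1 rho2 : Prop :=
  exists2 M : 'M[F]_2, M \in unitmx & forall s, rho1 s *m M = M *m rho2 s.

Definition unramified_at (p : nat) rho : Prop :=
  forall P s, prime_over Zbar p P -> inertia P s -> rho s = 1%:M.

(* The mod l cyclotomic character: s z = z ^ a for all the l-th roots of
   unity z, where chi_l(s) = a mod l. *)
Definition cyclotomic_char (l : nat) (s : absGal) : F :=
  if [pick a : 'I_l | `[< forall z : algC, z ^+ l = 1 -> s z = z ^+ a >]]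
  is Some a then (a : nat)%:R else 0.

Definition twist_rep rho (chi : absGal -> F) (i : nat) : absGal -> 'M[F]_2 :=
  fun s => chi s ^+ i *: rho s.

End GaloisRep.

(* rho is (in the isomorphism class of) the representation attached to the
   normalized eigenform g on Gamma1 n of weight k and to a prime mu over l,
   where r is a residue embedding for mu. *)
Definition attached_rep (R : realType) (F : fieldType) (l n k : nat)
    (g : R[i] -> R[i]) (r : R[i] -> F) (rho : absGal -> 'M[F]_2) : Prop :=
  [/\ is_rep rho, continuous_rep rho, semisimple_rep rho,
      forall p, prime p -> ~~ (p %| n * l)%N -> unramified_at p rho
    & forall p P s, prime p -> ~~ (p %| n * l)%N ->
        prime_over Zbar p P -> frobenius p P s ->
        char_poly (rho s) =
          'X^2 - (r (qcoef g p))%:P * 'X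
          + (r (nebentypus n k g p * p%:R ^+ k.-1))%:P].

(* x ^ m, where a negative power means a power of an inverse of x modulo l *)
Definition zpowmod (l x : nat) (m : int) : nat :=
  match m with
  | Posz e => (x ^ e)%N
  | Negz e => (((x%:R : 'F_l)^-1 : nat) ^ e.+1)%N
  end.

Definition setH (R : realType) (l N k i : nat) (f : R[i] -> R[i])
    (lam : set R[i]) : set nat :=
  [set x | [/\ (0 < x < N * l)%N, coprime x (N * l)
             & lam (nebentypus N k f x
                    * (zpowmod l x (k%:Z - 2 - 2 * i%:Z))%:R - 1)]].

(* Main.v *)
(* As f is a form on Gamma0 N, its nebentypus is trivial, and lambda contracts
   to l Z, so that H consists of the classes x with x^(k-2-2i) = 1 in F_l.
   Every class in (Z/Nl)^* is the lower right entry of an element of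
   Gamma0 (N l); hence Gamma_H is the whole group iff H = (Z/Nl)^* iff, by the
   surjectivity of (Z/Nl)^* -> F_l^*, the exponent k-2-2i kills F_l^*, which is
   cyclic of order l-1. *)
Require Import Defs.

(** If [p] did not divide [z], a Bezout relation between [p] and [z] would put 1 in [I]. *)
Lemma prime_over_int (A : comNzRingType) (O I : set A) (p : nat) (z : int) :
  prime p -> (forall m : int, O m%:~R) -> prime_over O p I ->
  I z%:~R <-> (p %| z)%Z.
Proof.
move=> p_pr OZ [[_ [I0 I1] ID IM _] Ip]; split; last first.
  by case/dvdzP=> q ->; rewrite intrM; apply: IM.
move=> Iz; apply: contrapT => /negP p'z; apply: I1.
have /coprimezP[[u v] /= uv1] : coprimez p z.
  by rewrite coprimezE prime_coprime //; apply: contraNN p'z; rewrite dvdzE.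
have -> : (1 : A) = u%:~R * p%:R + v%:~R * z%:~R.
  by rewrite -[p%:R]/((Posz p)%:~R) -!intrM -intrD uv1.
by apply: ID; apply: IM.
Qed.

Lemma integers_of_coef_field_int (R : realType) (f : R[i] -> R[i]) (m : int) :
  integers_of (coef_field f) m%:~R.
Proof.
split; first rewrite /coef_field /=.
  move=> S [S1 SB _] _.
  have S0 : 0 \in S by have := SB _ _ S1 S1; rewrite subrr.
  have SN x : x \in S -> - x \in S by rewrite -sub0r; apply: SB.
  have Sn n : n%:R \in S.
    by elim: n => // n Sn; have := SB _ _ Sn (SN _ S1); rewrite opprK natr1.
  by case: m => n; [|rewrite NegzE mulrNz; apply: SN]; apply: Sn.
exists ('X - m%:P); first exact: monicXsubC.
by rewrite rmorphB /= map_polyX map_polyC /= root_XsubC.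
Qed.

(** By Fermat only the remainder [r] of [z] modulo [p.-1] matters. If [0 < r], the [p.-1] nonzero
    elements would all be roots of [X^r - 1], which has at most [r < p.-1] roots. *)
Lemma expz_units_Fp (p : nat) (z : int) : prime p ->
  (forall x : 'F_p, x != 0 -> x ^ z = 1) <-> (p.-1 %| z)%Z.
Proof.
move=> p_pr; have p_gt1 := prime_gt1 p_pr.
have p1_gt0 : (0 < p.-1)%N by rewrite -ltnS prednK // ltnW.
have fermat (x : 'F_p) : x != 0 -> x ^ p.-1 = 1.
  move=> x0; apply: (mulfI x0).
  rewrite -exprnP -exprS prednK ?prime_gt0 // mulr1.
  by have := expf_card x; rewrite card_Fp.
set r := `|(z %% p.-1)%Z|%N.
have zmodE : (z %% p.-1)%Z = r by rewrite gez0_abs // modz_ge0 // -lt0n.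
have r_lt : (r < p.-1)%N by rewrite -ltz_nat -zmodE ltz_pmod.
have exp_mod (x : 'F_p) : x != 0 -> x ^ z = x ^+ r.
  move=> x0; rewrite [in LHS](divz_eq z p.-1) zmodE expfzDr //.
  by rewrite [X in _ ^ X]mulrC -exprz_exp fermat // exp1rz mul1r.
split=> [z1|/dvdz_mod0P z0 x x0]; last first.
  by rewrite exp_mod // /r z0.
apply/dvdz_mod0P; rewrite zmodE; case: (posnP r) => [-> //|r_gt0].
have := @max_unity_roots 'F_p r (enum (predC1 0)) r_gt0.
rewrite enum_uniq -cardE cardC1 card_Fp // leqNgt r_lt => H.
have /H : all r.-unity_root (enum (predC1 0 : pred 'F_p)).
  apply/allP => x; rewrite mem_enum inE => x0.
  by rewrite unity_rootE -exp_mod // z1.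
by move=> /(_ isT).
Qed.

Lemma natr_zpowmod (p x : nat) (m : int) :
  (zpowmod p x m)%:R = x%:R ^ m :> 'F_p.
Proof.
case: m => e; first by rewrite natrX.
by rewrite [zpowmod _ _ _]/(_ ^ _)%N natrX natr_Zp NegzE exprVn.
Qed.

(** The diamond operator slashes by an element of [Gamma0 n], hence fixes [f]; a point where [f] is
    nonzero then forces the eigenvalue. *)
Lemma nebentypus_Gamma0 (R : realType) (n k d : nat) (f : R[i] -> R[i]) :
  cusp_form (Gamma0 n) k f -> (exists2 z, upper_half_plane z & f z != 0) ->
  nebentypus n k f d = 1.
Proof.
case=> _ f_inv _ [z uz fz].
have diamond_id : eq_on_uhp (diamond n k d f) f.
  apply: f_inv; case: xgetP => [g _ [] //|_].
  (* When no matrix qualifies, [xget] returns its default, the identity, which also lies in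
     [Gamma0 n]. *)
  split; rewrite /SL2Z /= ?det1 ?mxE //=.
  by exists 1%N => //=; rewrite coprime1n.
apply: xget_unique => [|c] /=.
  by move=> w uw; rewrite diamond_id // mul1r.
move=> c_eig; have := c_eig z (mem_set uz).
by rewrite diamond_id ?inE // -[LHS]mul1r => /(mulIf fz).
Qed.

Lemma det_mx2 (A : comNzRingType) (M : 'M[A]_2) :
  \det M = M 0 0 * M 1 1 - M 0 1 * M 1 0.
Proof.
rewrite (expand_det_row _ 0) !big_ord_recl big_ord0 addr0.
rewrite /cofactor !det_mx11 !mxE /= expr0 mul1r expr1 mulN1r mulrN.
by congr (_ * M _ _ - M _ _ * M _ _); apply: val_inj.
Qed.

Lemma SL2Z_bottom_row (n d : nat) : coprime n d ->
  exists g, [/\ SL2Z g, g 1 0 = n & g 1 1 = d].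
Proof.
move=> nd; have /coprimezP[[u v] /= uv1] : coprimez n d by rewrite coprimezE.
exists (\matrix_(i, j) if i == 0 then if j == 0 then v else - u
                       else if j == 0 then n%:Z else d%:Z).
by rewrite /SL2Z /= det_mx2 !mxE /=; split=> //; rewrite mulNr opprK addrC.
Qed.

(** Every unit modulo [n] is the lower right entry of a matrix in [Gamma0 n]. As [H] holds reduced
    representatives, congruence to an element of [H] becomes equality. *)
Lemma GammaH_eq_Gamma0 (n : nat) (H : set nat) :
  (0 < n)%N -> (forall x, H x -> (x < n)%N /\ coprime x n) ->
  GammaH n H = Gamma0 n <-> (forall x, (x < n)%N -> coprime x n -> H x).
Proof.
move=> n_gt0 Hn; split=> [GE x x_lt xn|Hall].
  have [g [g1 gn gx]] : exists g, [/\ SL2Z g, g 1 0 = n & g 1 1 = x].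
    by apply: SL2Z_bottom_row; rewrite coprime_sym.
  have : Gamma0 n g by split; rewrite ?gn ?gx ?dvdzz //; exists x.
  rewrite -GE => -[_ _ [y Hy]].
  rewrite gx !modz_nat => -[]; rewrite !modn_small //; first by move=> ->.
  by case: (Hn _ Hy).
apply/seteqP; split=> g [g1 gn [x /= Hx gx]]; split=> //.
  by exists x => //=; case: (Hn _ Hx).
exists (x %% n)%N; last by rewrite gx !modz_nat modn_mod.
by apply: Hall; rewrite ?ltn_mod // coprime_modl.
Qed.

Theorem corollary5p3 (R : realType) (l N k : nat) (F : closedFieldType)
    (hl : prime l) (l5 : (5 <= l)%N) (hF : algebraic_closure_Fp l F)
    (N0 : (0 < N)%N) (Nl : coprime N l) (k2 : (2 < k)%N)
    (f : R[i] -> R[i])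
    (f_cusp : cusp_form (Gamma0 N) k f)
    (f_eigen : normalized_eigenform N k f)
    (lam : set R[i])
    (hlam : prime_over (integers_of (coef_field f)) l lam)
    (r : R[i] -> F)
    (hr : residue_embedding (integers_of (coef_field f)) lam r)
    (rho : absGal -> 'M[F]_2)
    (hrho : attached_rep l N k f r rho)
    (irr_rho : irreducible_rep rho)
    (i : nat) (hi : (i <= l - 1)%N)
    (hf2 : exists (f2 : R[i] -> R[i]) (lam2 : set R[i]) (r2 : R[i] -> F)
             (rho2 : absGal -> 'M[F]_2),
        [/\ cusp_form (GammaH (N * l) (setH l N k i f lam)) 2 f2
              /\ normalized_eigenform (N * l) 2 f2,
            prime_over (integers_of (coef_field f2)) l lam2,
            residue_embedding (integers_of (coef_field f2)) lam2 r2,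
            attached_rep l (N * l) 2 f2 r2 rho2
          & isomorphic_rep rho (twist_rep rho2 (@cyclotomic_char F l) i)]) :
  GammaH (N * l) (setH l N k i f lam) = Gamma0 (N * l)
  <-> (l.-1%:Z %| k%:Z - 2 - 2 * i%:Z)%Z.
Proof.
have Nl_gt0 : (0 < N * l)%N by rewrite muln_gt0 N0 prime_gt0.
have Nl_gt1 : (1 < N * l)%N.
  exact: leq_trans (prime_gt1 hl) (leq_pmull _ N0).
(* The factor 1 stands for the value of the trivial nebentypus in [setH]. *)
have lamE m : lam (1 * m%:R - 1) <-> m%:R = 1 :> 'F_l.
  rewrite mul1r (_ : m%:R - 1 = (m%:Z - 1)%:~R); last by rewrite intrB.
  rewrite (prime_over_int _ _ _ _ _ hl (integers_of_coef_field_int R f) hlam).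
  rewrite (dvdz_pcharf (pchar_Fp hl)) intrB subr_eq0.
  by split=> /eqP.
rewrite GammaH_eq_Gamma0 //; last by move=> x [/andP[_ ? ] ? _].
rewrite -(expz_units_Fp _ _ hl).
have [f_neq0 _ _ _] := f_eigen.
rewrite /setH; split=> [Hall u u0|Hall x x_lt xNl]; last first.
  split=> //.
    (* The class 0 is excluded because its gcd with [N * l] is [N * l > 1]. *)
    rewrite x_lt lt0n andbT; apply: contraTneq xNl => ->.
    by rewrite /coprime gcd0n gtn_eqF.
  rewrite (nebentypus_Gamma0 _ _ _ _ _ f_cusp f_neq0); apply/lamE.
  rewrite natr_zpowmod; apply: Hall.
  rewrite -(dvdn_pcharf (pchar_Fp hl)) -prime_coprime // coprime_sym.
  by move: xNl; rewrite coprimeMr => /andP[].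
(* Lift [u] to a unit modulo [N * l]: being 1 modulo [N] makes [y] prime to [N], and [u != 0] makes
   it prime to [l]. *)
pose y := chinese N l 1 u.
have yu : y%:R = u.
  rewrite -[RHS]natr_Zp; apply: val_inj.
  by rewrite /= !(val_Fp_nat hl) chinese_modr.
have yNl : coprime y (N * l).
  rewrite coprimeMr -[X in X && _]coprime_modl chinese_modl // coprime_modl.
  rewrite coprime1n /= coprime_sym prime_coprime //.
  by rewrite (dvdn_pcharf (pchar_Fp hl)) yu.
have := Hall (y %% (N * l))%N; rewrite ltn_mod coprime_modl.
case/(_ Nl_gt0 yNl) => _ _; rewrite (nebentypus_Gamma0 _ _ _ _ _ f_cusp f_neq0).
move/lamE; rewrite natr_zpowmod.
(* Reducing [y] modulo [N * l] keeps its class modulo [l]. *)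
suff -> : (y %% (N * l))%:R = u by [].
rewrite -yu; apply: val_inj; rewrite /= !(val_Fp_nat hl) modn_dvdm //.
exact: dvdn_mull.
Qed.
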